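(* Let $\mathcal{F}_{\mathrm{sq}}=\{G \mid e(G)=k^2,\ k\ge 1\}$ be the family of all graphs having a square number of edges. For every $p\ge 5$, $f(n,K_p|\mathcal{F}_{\mathrm{sq}})=(1+o(1))\,\mathrm{ex}(n,K_{\lceil p/2\rceil})$ as $n\to\infty$.
   Context: $e(G)$ is the number of edges of $G$; $k$ ranges over positive integers. $\mathrm{ex}(n,F)$ is the Turán number: the maximum number of edges in a graph of order $n$ containing no subgraph isomorphic to $F$. In an edge coloring of $K_n$ (not necessarily proper), for a copy $G'\subseteq K_n$ of a graph $G$, a color class of $G'$ is the graph (without isolated vertices) formed by all edges of $G'$ having a given color that occurs in $G'$. For a family $\mathcal{F}$ of graphs (closed under isomorphism) with $K_2\in\mathcal{F}$, and $n\ge |G|$, $f(n,G|\mathcal{F})$ is the smallest integer $m$ such that in every edge coloring of $K_n$ using at least $m$ colors there exists a copy of $G$ in which all color classes are members of $\mathcal{F}$. *)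

(* Defs.v *)
From mathcomp Require Import all_boot.
From mathcomp Require Import boolp.

Set Implicit Arguments.
Unset Strict Implicit.
Unset Printing Implicit Defensive.

Record sgraph := SGraph {
  vert :> finType;
  edges : {set {set vert}};
  edges_card : {in edges, forall e : {set vert}, #|e| = 2}
}.

Section Complete.
Variable n : nat.

Definition complete_edges : {set {set 'I_n}} := [set e : {set 'I_n} | #|e| == 2].

Lemma complete_edges_card :
  {in complete_edges, forall e : {set 'I_n}, #|e| = 2}.
Proof. by move=> e; rewrite inE => /eqP. Qed.

Definition complete : sgraph := SGraph complete_edges_card.

End Complete.

(* The graph without isolated vertices whose edges are the pairs in A; the
   vertices that remain are exactly those covered by A. *)
Section EdgeGraph.
Variables (T : finType) (A : {set {set T}}).

Definition edge_graph_edges : {set {set {x : T | x \in cover A}}} :=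
  [set e : {set {x : T | x \in cover A}} |
     (#|e| == 2) && (val @: e \in A)].

Lemma edge_graph_edges_card :
  {in edge_graph_edges, forall e : {set {x : T | x \in cover A}}, #|e| = 2}.
Proof. by move=> e; rewrite inE => /andP[/eqP]. Qed.

Definition edge_graph : sgraph := SGraph edge_graph_edges_card.

End EdgeGraph.

(* A copy of G on the vertex set T is given by an injective h : G -> T; these
   are the edges of the copy. *)
Definition copy_edges (G : sgraph) (T : finType) (h : {ffun G -> T}) :
    {set {set T}} :=
  [set h @: (e : {set G}) | e in edges G].

(* The graph on T with edge set E has a (not necessarily induced) subgraph
   isomorphic to G. *)
Definition has_copy (G : sgraph) (T : finType) (E : {set {set T}}) : bool :=
  [exists h : {ffun G -> T}, injectiveb h && (copy_edges h \subset E)].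

(* Turan number: E ranges over the edge sets of the graphs on 'I_n. *)
Definition turan_ex (n : nat) (F : sgraph) : nat :=
  \max_(E : {set {set 'I_n}} | (E \subset edges (complete n)) && ~~ has_copy F E)
    #|E|.

(* An edge coloring of K_n is a c : {set 'I_n} -> nat of which only the values
   on the edges of K_n matter. *)
Definition colors_on (T : finType) (c : {set T} -> nat) (E : {set {set T}}) :
    seq nat :=
  undup [seq c e | e in E].

Definition color_class (T : finType) (c : {set T} -> nat) (E : {set {set T}})
    (a : nat) : {set {set T}} :=
  [set e in E | c e == a].

Section ForcingNumber.
Variables (n : nat) (G : sgraph) (F : sgraph -> Prop).

Definition classes_copy (c : {set 'I_n} -> nat) : Prop :=
  exists2 h : {ffun G -> 'I_n}, injective h &
    forall a : nat, a \in colors_on c (copy_edges h) ->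
      F (edge_graph (color_class c (copy_edges h) a)).

Definition forces (m : nat) : Prop :=
  forall c : {set 'I_n} -> nat,
    m <= size (colors_on c (edges (complete n))) -> classes_copy c.

Lemma forces_ex : exists m, `[< forces m >].
Proof.
exists #|edges (complete n)|.+1; apply/asboolP => c.
move=> lt_c; exfalso; move: lt_c; apply/negP; rewrite -leqNgt.
by rewrite (leq_trans (size_undup _)) // size_map -cardE.
Qed.

(* f(n, G | F), meaningful for n >= #|G|. *)
Definition forcing_number : nat := ex_minn forces_ex.

End ForcingNumber.

Definition square_graphs (G : sgraph) : Prop :=
  exists2 k : nat, 1 <= k & #|edges G| = k ^ 2.

(* Main.v *)
Require Import Defs.
From mathcomp Require Import all_boot.
From mathcomp Require Import boolp zify ring.

Set Implicit Arguments.
Unset Strict Implicit.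
Unset Printing Implicit Defensive.

(** Write [q] for half of [p], rounded up; note that [q >= 3].

    Lower bound: [f(n, K_p) > ex(n, K_q)]. By Turan's theorem (in Erdos's form,
    [degree_majorization]) some complete [(q - 1)]-partite graph has at least
    [ex(n, K_q)] edges. Give these edges distinct colours, and colour an edge inside
    a class by its larger endpoint. As [p > 2 (q - 1)], a copy of [K_p] has three
    vertices in one class, and then some vertex is the larger endpoint of exactly
    two inner edges of the copy: a colour class of size [2]
    ([star_coloring_avoids]).

    Upper bound: with at least [(1 + 1 / K) ex(n, K_q)] colours and [n] large, keep
    one edge of each colour. By the Erdos-Stone theorem ([erdos_stone]) this rainbow
    graph contains a complete [q]-partite graph with large parts, and passing to
    smaller parts, no edge inside a part has the colour of an edge between parts
    ([conflict_free_blocks]). Edges between parts are then harmless: only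
    the edges inside the parts matter ([square_classes_of_inner]). By Ramsey's
    theorem, each part contains either a monochromatic [K_(k+1)], with
    [k = (p - 1) / 2] rounded down, or many colours. If two parts have such
    cliques of the same colour, take [k + 1] vertices of one and [k] of the other,
    and one vertex in a third part if [p] is even: the only nontrivial class has
    [C(k+1, 2) + C(k, 2) = k ^ 2] edges ([monochromatic_selection]). Otherwise the
    parts contain edges of pairwise distinct colours, and the union of these edges,
    minus one vertex if [p] is odd, spans a rainbow [K_p]
    ([matching_selection]). *)

(** * Subsets and pigeonhole *)

Definition take_set (T : finType) k (A : {set T}) : {set T} :=
  [set x in take k (enum A)].

Lemma take_set_sub (T : finType) k (A : {set T}) : take_set k A \subset A.
Proof. by apply/subsetP => x; rewrite inE => /mem_take; rewrite mem_enum. Qed.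

Lemma card_take_set (T : finType) k (A : {set T}) :
  k <= #|A| -> #|take_set k A| = k.
Proof.
move=> kA; rewrite cardsE.
have /card_uniqP -> : uniq (take k (enum A)) by rewrite take_uniq ?enum_uniq.
by rewrite size_takel -?cardE.
Qed.

Lemma pigeonhole (T U : finType) (f : T -> U) (A : {set T}) (B : {set U}) k :
  {in A, forall x, f x \in B} -> #|B| * k < #|A| ->
  exists2 b, b \in B & k < #|[set x in A | f x == b]|.
Proof.
move=> fAB lt.
case: (boolP [exists b in B, k < #|[set x in A | f x == b]|]).
  by case/existsP => b /andP[]; exists b.
rewrite negb_exists => /forallP H; exfalso; move: lt; apply/negP; rewrite -leqNgt.
rewrite -sum1_card (partition_big f (mem B)) //=.
rewrite -sum_nat_const; apply: leq_sum => b bB.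
have := H b; rewrite bB /= -leqNgt; apply: leq_trans.
by rewrite -sum1_card; apply: eq_leq; apply: eq_bigl => x; rewrite inE.
Qed.

Lemma pigeonhole_nat (T : finType) (f : T -> nat) (A : {set T}) N k :
  {in A, forall x, f x < N} -> N * k < #|A| ->
  exists2 b, b < N & k < #|[set x in A | f x == b]|.
Proof.
case: N => [|N] fN ltA.
  by case/card_gt0P: (leq_ltn_trans (leq0n _) ltA) => x /fN.
have [||b _ lt] := @pigeonhole _ 'I_N.+1 (fun x => inord (f x)) A setT k.
- by move=> x _; rewrite inE.
- by rewrite cardsT card_ord.
exists b => //; apply: leq_trans lt _; apply: subset_leq_card.
by apply/subsetP => x; rewrite !inE => /andP[xA /eqP <-]; rewrite xA inordK ?eqxx ?fN.
Qed.

Definition pairs (T : finType) (X : {set T}) : {set {set T}} :=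
  [set e : {set T} | e \subset X & #|e| == 2].

Lemma card_pairs (T : finType) (X : {set T}) : #|pairs X| = 'C(#|X|, 2).
Proof. exact: cards_draws. Qed.

Lemma pairsP (T : finType) (X e : {set T}) :
  reflect (exists x y, [/\ x \in X, y \in X, x != y & e = [set x; y]]) (e \in pairs X).
Proof.
apply: (iffP idP) => [|[x [y [xX yX xy ->]]]]; rewrite inE.
  case/andP => sub /cards2P[x [y [xy eE]]]; exists x, y.
  by split=> //; apply: (subsetP sub); rewrite eE !inE eqxx ?orbT.
by rewrite cards2 xy subUset !sub1set xX yX.
Qed.

Lemma pairsS (T : finType) (X Y : {set T}) : X \subset Y -> pairs X \subset pairs Y.
Proof.
by move=> XY; apply/subsetP => e; rewrite !inE => /andP[/subset_trans->].
Qed.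

(** * Copies of complete graphs and edge counts *)

Lemma card_edge_graph (T : finType) (A : {set {set T}}) :
  {in A, forall e : {set T}, #|e| = 2} -> #|edges (edge_graph A)| = #|A|.
Proof.
move=> A2.
rewrite /= -(card_imset (mem (edge_graph_edges A)) (imset_inj val_inj)).
apply: eq_card => e; apply/imsetP/idP => [[e' ]|eA].
  by rewrite inE => /andP[_ h ->].
have ecov x : x \in e -> x \in cover A by move=> xe; apply/bigcupP; exists e.
exists (val @^-1: e); last first.
  apply/setP => x; apply/idP/imsetP => [xe|[y]]; last by rewrite inE => ye ->.
  by exists (Sub x (ecov x xe)); rewrite ?inE SubK.
have E : val @: (val @^-1: e : {set {x : T | x \in cover A}}) = e.
  apply/setP => x; apply/imsetP/idP => [[y]|xe]; first by rewrite inE => ye ->.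
  by exists (Sub x (ecov x xe)); rewrite ?inE SubK.
by rewrite inE E eA -(card_imset _ val_inj) E A2 // eqxx.
Qed.

Lemma copy_edges_complete p n (h : {ffun complete p -> 'I_n}) :
  injective h -> copy_edges h = pairs (h @: setT).
Proof.
move=> hI; apply/setP => e; apply/imsetP/idP => [[e' e'2 ->]|].
  rewrite inE imsetS ?subsetT // card_imset //.
  by move: e'2; rewrite /= inE.
case/pairsP => x [y [/imsetP[i _ ->] /imsetP[j _ ->] ij ->]].
exists [set i; j]; last by rewrite imsetU !imset_set1.
by rewrite /= inE cards2; case: (i =P j) ij => [->|]; rewrite ?eqxx.
Qed.

(** A copy of [K_p] is determined, as far as its edges go, by its [p] vertices,
    so the embedding can be forgotten. A colour that does not occur gives an
    empty class, and [0] is a square, hence the quantification over all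
    colours. *)
Lemma classes_copyP p n (c : {set 'I_n} -> nat) :
  classes_copy (complete p) square_graphs c <->
  exists2 X : {set 'I_n}, #|X| = p &
    forall a, exists k, #|[set e in pairs X | c e == a]| = k ^ 2.
Proof.
have aux (X : {set 'I_n}) a :
    #|edges (edge_graph (color_class c (pairs X) a))| = #|[set e in pairs X | c e == a]|.
  by rewrite card_edge_graph // => e; rewrite !inE => /andP[/andP[_ /eqP]].
split=> [[h hI H]|[X Xp H]].
  exists (h @: setT); first by rewrite card_imset // cardsT card_ord.
  move=> a; rewrite copy_edges_complete // in H.
  case: (boolP (a \in colors_on c (pairs (h @: setT)))) => [/H[k _]|].
    by rewrite aux; exists k.
  move=> aN; exists 0; apply: eq_card0 => e; rewrite inE; apply/negP => /andP[eX /eqP ea].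
  by case/negP: aN; rewrite mem_undup -ea; apply/mapP; exists e; rewrite ?mem_enum.
pose h := [ffun i : complete p => enum_val (cast_ord (esym Xp) i)].
have hI : injective h by move=> i j; rewrite !ffunE => /enum_val_inj /cast_ord_inj.
have hX : h @: setT = X.
  apply/eqP; rewrite eqEcard card_imset // cardsT card_ord Xp leqnn andbT.
  by apply/subsetP => x /imsetP[i _ ->]; rewrite ffunE enum_valP.
exists h => // a; rewrite copy_edges_complete // hX => aC.
case: (H a) => k Hk; exists k; last by rewrite aux.
case: k Hk => // Hk; exfalso; move: aC; rewrite mem_undup => /mapP[e].
rewrite mem_enum => eX ea.
by have := cards0_eq Hk => /setP/(_ e); rewrite in_set0 in_set eX -ea eqxx.
Qed.

Lemma edges_completeE n : edges (complete n) = pairs setT.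
Proof. by apply/setP => e; rewrite /= !inE subsetT. Qed.

Lemma has_copy_completeP q (T : finType) (E : {set {set T}}) :
  reflect (exists2 h : 'I_q -> T, injective h & forall i j, i != j -> [set h i; h j] \in E)
    (has_copy (complete q) E).
Proof.
apply: (iffP existsP) => [[h /andP[/injectiveP hI /subsetP sub]]|[h hI H]].
  exists h => // i j ij; apply: sub; apply/imsetP; exists [set i; j].
    by rewrite /= inE cards2 ij.
  by rewrite imsetU !imset_set1.
exists [ffun i => h i]; apply/andP; split.
  by apply/injectiveP => i j; rewrite !ffunE => /hI.
apply/subsetP => e /imsetP[e']; rewrite /= inE => /cards2P[i [j [ij ->]]] ->.
by rewrite imsetU !imset_set1 !ffunE H.
Qed.

(** One edge of each colour: this turns a bound on the number of colours into a
    bound on the number of edges of a graph, to which Turan theory applies. *)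
Lemma rainbow_repr (T : finType) (c : {set T} -> nat) (F : {set {set T}}) :
  exists E : {set {set T}},
    [/\ E \subset F, {in E &, injective c} & size (colors_on c F) <= #|E|].
Proof.
pose R a := odflt set0 [pick e in F | c e == a].
have RP e : e \in F -> R (c e) \in F /\ c (R (c e)) = c e.
  move=> eF; rewrite /R; case: pickP => [e' /andP[? /eqP]|] //=.
  by move=> /(_ e); rewrite eF eqxx.
exists [set R (c e) | e in F]; split.
- by apply/subsetP => x /imsetP[e /RP[? _] ->].
- by move=> x y /imsetP[e /RP[_ e1] ->] /imsetP[e' /RP[_ e2] ->]; rewrite e1 e2 => ->.
rewrite cardE -(size_map c) uniq_leq_size ?undup_uniq // => a.
rewrite mem_undup => /mapP[e]; rewrite mem_enum => eF ->.
apply/mapP; exists (R (c e)); last by case: (RP e eF).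
by rewrite mem_enum; apply/imsetP; exists e.
Qed.

Lemma handshake (T : finType) (E : {set {set T}}) :
  E \subset pairs setT -> \sum_x #|[set y | [set x; y] \in E]| = #|E|.*2.
Proof.
move=> sE.
have -> : \sum_x #|[set y | [set x; y] \in E]| = \sum_(u : T * T | [set u.1; u.2] \in E) 1.
  rewrite -(pair_big_dep xpredT (fun x y => [set x; y] \in E) (fun _ _ => 1)) /=.
  by apply: eq_bigr => x _; rewrite -sum1_card; apply: eq_bigl => y; rewrite inE.
rewrite (partition_big (fun u : T * T => [set u.1; u.2]) (mem E)) //=.
rewrite -muln2 -sum_nat_const; apply: eq_bigr => e eE.
have /pairsP[x [y [_ _ xy ee]]] := subsetP sE e eE.
have -> : \sum_(u : T * T | ([set u.1; u.2] \in E) && ([set u.1; u.2] == e)) 1 = #|[set (x, y); (y, x)]|.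
  rewrite -sum1_card; apply: eq_bigl => -[a b] /=; rewrite !inE.
  apply/andP/orP => [[_ /eqP ab]|].
    have : a \in e by rewrite -ab !inE eqxx.
    have : b \in e by rewrite -ab !inE eqxx orbT.
    have : #|[set a; b]| = 2 by rewrite ab ee cards2 xy.
    rewrite cards2 ee !inE; case: eqP => // /eqP ab' _.
    case/orP => /eqP eb; case/orP => /eqP ea; subst a b; rewrite ?eqxx in ab' *; auto.
  case=> /eqP[-> ->]; rewrite -?(setUC [set x]) -ee eE eqxx //.
by rewrite cards2 xpair_eqE negb_and xy.
Qed.

(** * Ramsey's theorem *)

(** Ramsey's theorem with a prescribed size for each colour. Induction on the
    total size [s]: a vertex [v] sends more than [t] edges of some colour [a], and
    inside that neighbourhood the demand on [a] drops by one, since [v] can be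
    added back. The demand on a colour may be [0], and the empty set meets it. *)
Lemma ramsey_vec N s : exists t, forall k : nat -> nat,
  0 < N -> \sum_(a < N) k a <= s ->
  forall (T : finType) (c : {set T} -> nat) (B : {set T}), t <= #|B| ->
  {in pairs B, forall e, c e < N} ->
  exists a (K : {set T}), [/\ a < N, K \subset B, k a <= #|K| & {in pairs K, forall e, c e = a}].
Proof.
have triv (k : nat -> nat) (T : finType) (c : {set T} -> nat) (B : {set T}) (a : 'I_N) : k a = 0 ->
  exists a (K : {set T}), [/\ a < N, K \subset B, k a <= #|K| & {in pairs K, forall e, c e = a}].
  move=> ka; exists a, set0; rewrite sub0set ka; split=> // e /pairsP[x [y []]].
  by rewrite inE.
elim: s => [|s [t IH]].
  exists 0 => k N0 /[!leqn0] /[!sum_nat_eq0] /forallP H T c B _ _.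
  by apply: (triv _ _ _ _ (Ordinal N0)); apply/eqP/H.
exists (N * t).+2 => k N0 ks T c B tB cB.
case: (boolP [exists a : 'I_N, k a == 0]) => [/existsP[a /eqP]|]; first exact: triv.
rewrite negb_exists => /forallP kP.
have /card_gt0P[v vB] : 0 < #|B| by lia.
have vx x : x \in B :\ v -> [set v; x] \in pairs B.
  by case/setD1P => xv xB; apply/pairsP; exists v, x; split; rewrite // eq_sym.
have [||a aN lt] := @pigeonhole_nat _ (fun x => c [set v; x]) (B :\ v) N t _ _.
- by move=> x /vx /cB.
- by move: tB; rewrite (cardsD1 v B) vB; lia.
set B' := [set _ in _ | _] in lt.
have B'B : B' \subset B by apply/subsetP => x; rewrite !inE => /andP[/andP[]].
pose k' b := k b - (b == a).
have [|||b [K [bN KB kK cK]]] := IH k' N0 _ T c B'.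
- have kE : \sum_(b < N) k b = (\sum_(b < N) k' b) + 1.
    rewrite (bigD1 (Ordinal aN)) // [X in _ = X + _](bigD1 (Ordinal aN)) //=.
    rewrite {1}/k' eqxx -addnA [_ + 1]addnC addnA.
    have := kP (Ordinal aN) => /= ka.
    congr (_ + _); first by lia.
    apply: eq_bigr => b ba; rewrite /k'; case: (altP (b =P a :> nat)) => [ba'|]; last by rewrite subn0.
    by case/eqP: ba; apply: val_inj.
  by lia.
- exact: ltnW.
- by move=> e eB'; apply: cB; apply: (subsetP (pairsS B'B)).
case: (altP (b =P a)) => [ba|ba]; last first.
  exists b, K; split=> //; first exact: subset_trans KB B'B.
  by apply: leq_trans kK; rewrite /k' (negbTE ba) subn0.
exists a, (v |: K); split=> //.
- by rewrite subUset sub1set vB (subset_trans KB B'B).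
- have vK : v \notin K by apply/negP => /(subsetP KB); rewrite !inE eqxx.
  by rewrite cardsU1 vK; move: kK; rewrite /k' ba eqxx; lia.
have vK x : x \in K -> c [set v; x] = a.
  by move=> /(subsetP KB); rewrite inE => /andP[_ /eqP].
move=> e /pairsP[x [y []]]; rewrite !inE => /orP[/eqP->|xK] /orP[/eqP->|yK] xy ->.
- by rewrite eqxx in xy.
- exact: vK.
- by rewrite setUC vK.
- by rewrite -ba; apply: cK; apply/pairsP; exists x, y.
Qed.

(** The number of colours is not bounded here: a part that shows more than [N]
    colours is just as useful, as it offers many choices for a single edge. *)
Lemma ramsey N k : exists t, forall (T : finType) (c : {set T} -> nat) (B : {set T}),
  t <= #|B| ->
  N < size (colors_on c (pairs B)) \/
  exists a (K : {set T}), [/\ K \subset B, #|K| = k & {in pairs K, forall e, c e = a}].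
Proof.
have [t tP] := ramsey_vec N.+1 (N.+1 * k).
exists t => T c B tB; case: (ltnP N (size (colors_on c (pairs B)))) => [|le]; first by left.
right; pose C := colors_on c (pairs B).
have cC e : e \in pairs B -> c e \in C.
  by move=> eB; rewrite mem_undup; apply/mapP; exists e; rewrite ?mem_enum.
have [|||a [K [_ KB kK cK]]] := tP (fun=> k) _ _ T (fun e => index (c e) C) B tB.
- by [].
- by rewrite sum_nat_const card_ord.
- by move=> e /cC; rewrite -index_mem ltnS => /ltnW/leq_trans; apply.
exists (nth 0 C a), (take_set k K); split.
- exact: subset_trans (take_set_sub _ _) KB.
- exact: card_take_set.
move=> e eK; have {}eK := subsetP (pairsS (take_set_sub _ _)) _ eK.
by rewrite -(cK e eK) nth_index // cC //; apply: (subsetP (pairsS KB)).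
Qed.

(** * The Erdos-Stone theorem *)

Definition blowup (T : finType) (e : rel T) s t (A : {set T}) :=
  exists P : nat -> {set T},
    (forall i, i < s -> P i \subset A /\ #|P i| = t) /\
    (forall i j x y, i < s -> j < s -> i != j -> x \in P i -> y \in P j -> e x y).

(** The inductive step of Erdos-Stone. Take [s] large parts of size [T' = 2 D t].
    Counting non-edges between them and [A], the vertices of [A] with fewer than
    [t] neighbours in some part make up at most a fraction
    [(2 D - 2) / (2 D - 1)] of [A]; among the others, more than [t] have the same
    neighbourhood in the parts. They form the new part, and each old part is
    cut down to [t] of its vertices in that neighbourhood. *)
Lemma blowup_min_degree r D s t : s <= r.+1 -> 0 < D -> 0 < t ->
  exists m0, forall (T : finType) (e : rel T) (A : {set T}),
  symmetric e -> m0 <= #|A| ->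
  {in A, forall v, D * r * #|[set u in A | ~~ e v u]| <= D.-1 * #|A|} ->
  blowup e s t A.
Proof.
move=> + D0; elim: s t => [|s IH] t sr t0.
  by exists 0 => T e A _ _ _; exists (fun=> set0).
have [||m1 m1P] := IH (2 * D * t); [by lia|by rewrite !muln_gt0 D0|].
set T' := 2 * D * t in m1P.
exists (m1 + 2 * D * (2 ^ (s * T') * t).+1) => T e A es mA nn.
have [|//|P [PA Pe]] := m1P T e A es; first by lia.
pose B := \bigcup_(i < s) P i.
have cB : #|B| <= s * T'.
  have -> : s * T' = \sum_(i < s) T' by rewrite sum_nat_const card_ord.
  rewrite /B; elim/big_ind2: _ => [|X a Y b|i _]; first by rewrite cards0.
    by move=> Xa Yb; rewrite (leq_trans (leq_card_setU _ _)) ?leq_add.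
  by rewrite (PA i _).2.
pose nb u i := [set x in P i | e u x].
pose bad := [set u in A | [exists i : 'I_s, #|nb u i| < t]].
have bad_small : #|bad| * (2 * D - 1) <= (2 * D - 2) * #|A|.
  (* a bad vertex misses at least T' - t vertices of one of the parts *)
  have badE : #|bad| * (T' - t) <= \sum_(i < s) \sum_(x in P i) #|[set u in A | ~~ e x u]|.
    have -> : \sum_(i < s) \sum_(x in P i) #|[set u in A | ~~ e x u]| =
              \sum_(u in A) \sum_(i < s) #|[set x in P i | ~~ e u x]|.
      rewrite exchange_big /=; apply: eq_bigr => i _.
      under eq_bigr do rewrite -sum1dep_card big_mkcondr /=.
      rewrite exchange_big /=; apply: eq_bigr => u _.
      by rewrite -big_mkcondr /= sum1dep_card; apply: eq_card => x; rewrite !inE es.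
    rewrite -sum_nat_const; apply: (@leq_trans (\sum_(u in bad) \sum_(i < s) #|[set x in P i | ~~ e u x]|)).
      apply: leq_sum => u; rewrite inE => /andP[uA /existsP[i lt]].
      rewrite (bigD1 i) //= (leq_trans _ (leq_addr _ _)) //.
      have [_ <-] := PA i (ltn_ord i).
      rewrite -(cardsID [set x | e u x] (P i)) leq_subLR leq_add //.
        by apply: leq_trans (ltnW lt); apply: eq_leq; apply: eq_card => x; rewrite !inE.
      by apply: eq_leq; apply: eq_card => x; rewrite !inE andbC.
    rewrite [leqRHS](bigID (mem bad)) /= (leq_trans _ (leq_addr _ _)) //.
    by apply: eq_leq; apply: eq_bigl => u; rewrite !inE andbA andbb.
  have nnE : D * r * (\sum_(i < s) \sum_(x in P i) #|[set u in A | ~~ e x u]|) <= s * (T' * (D.-1 * #|A|)).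
    have -> : s * (T' * (D.-1 * #|A|)) = \sum_(i < s) T' * (D.-1 * #|A|) by rewrite sum_nat_const card_ord.
    rewrite big_distrr; apply: leq_sum => i _; have [PiA <-] := PA i (ltn_ord i).
    rewrite -sum_nat_const big_distrr; apply: leq_sum => x xP.
    by apply: nn; apply: (subsetP PiA).
  have T't : T' - t = (2 * D - 1) * t by rewrite /T' mulnBl mul1n.
  case: (posnP s) => [s0|s0].
    rewrite s0 big_ord0 leqn0 T't !muln_eq0 subn_eq0 in badE.
    by case/or3P: badE => [/eqP->//||]; lia.
  have E1 : D * r * (#|bad| * (T' - t)) <= r * (T' * (D.-1 * #|A|)).
    apply: leq_trans (leq_mul (leqnn _) badE) _.
    by apply: leq_trans nnE _; rewrite leq_mul2r; apply/orP; right; lia.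
  rewrite T't /T' in E1.
  have rtD : 0 < r * (t * D) by rewrite !muln_gt0 t0 D0; lia.
  rewrite -(leq_pmul2l rtD).
  apply: leq_trans (leq_trans _ E1) _; first by apply: eq_leq; ring.
  by apply: eq_leq; rewrite (_ : 2 * D - 2 = 2 * D.-1); [ring|lia].
pose good := A :\: bad.
have good_large : 2 ^ #|B| * t < #|good|.
  have cA : #|A| = #|bad| + #|good|.
    rewrite -(cardsID bad A); congr (_ + _); apply: eq_card => u.
    by rewrite !inE andbA andbb.
  have le2 : 2 ^ #|B| * t <= 2 ^ (s * T') * t by rewrite leq_mul2r leq_exp2l ?cB ?orbT.
  apply: leq_ltn_trans le2 _; move: mA; set X := 2 ^ _ * t => mA.
  rewrite ltnNge; apply/negP => gX.
  have XA : 2 * D * X.+1 <= #|A| by apply: leq_trans (leq_addl _ _) mA.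
  have A1 : (2 * D - 1) * #|A| <= (2 * D - 2) * #|A| + (2 * D - 1) * X.
    by rewrite [in leqLHS]cA mulnDr leq_add ?leq_mul2l ?gX ?orbT // mulnC.
  have A2 : (2 * D - 1) * #|A| = (2 * D - 2) * #|A| + #|A|.
    by rewrite -[X in _ + X]mul1n -mulnDl; congr (_ * _); lia.
  have A3 : (2 * D - 1) * X <= 2 * D * X by rewrite leq_mul2r leq_subr orbT.
  by rewrite mulnS in XA; lia.
pose sg u := [set x in B | e u x].
have [||S _ lt] := @pigeonhole _ _ sg good (powerset B) t _ _.
- by move=> u _; rewrite inE; apply/subsetP => x; rewrite inE => /andP[].
- by rewrite card_powerset.
set U := [set _ in _ | _] in lt.
have UA u : u \in U -> [/\ u \in A, u \notin bad & sg u = S].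
  by rewrite !inE => /andP[/andP[-> ->]] /eqP.
have /card_gt0P[u0 /UA[u0A u0bad sg0]] : 0 < #|U| by apply: leq_ltn_trans lt.
have nbS i x : i < s -> x \in nb u0 i -> x \in S.
  move=> si; rewrite -sg0 !inE => /andP[xP ->]; rewrite andbT.
  by apply/bigcupP; exists (Ordinal si).
have nbP i x : x \in take_set t (nb u0 i) -> x \in nb u0 i.
  exact/subsetP/take_set_sub.
have nbPi i x : x \in nb u0 i -> x \in P i by rewrite inE => /andP[].
have Ue u i x : u \in take_set t U -> i < s -> x \in take_set t (nb u0 i) -> e u x.
  move=> /(subsetP (take_set_sub _ _)) /UA[_ _ sgu] si /nbP /(nbS _ _ si).
  by rewrite -sgu inE => /andP[].
exists (fun i => if i < s then take_set t (nb u0 i) else take_set t U); split.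
  move=> i _; case: ifP => si; split.
  - apply: subset_trans (take_set_sub _ _) _; apply: subset_trans (PA i si).1.
    by apply/subsetP => x; rewrite inE => /andP[].
  - apply: card_take_set; move: u0bad; rewrite inE u0A negb_exists /= => /forallP/(_ (Ordinal si)).
    by rewrite -leqNgt.
  - apply: subset_trans (take_set_sub _ _) _; apply/subsetP => u.
    by move=> /UA[].
  - exact/card_take_set/ltnW.
move=> i j x y; rewrite !ltnS => is_ js_ ij.
case: ifP => si; case: ifP => sj.
- by move=> /nbP/nbPi xi /nbP/nbPi yj; apply: (Pe i j).
- by move=> xi yu; rewrite es; apply: Ue yu si xi.
- by move=> xu; apply: Ue xu sj.
- by lia.
Qed.

(** The number of ordered adjacent pairs inside [A]: twice the number of edges,
    which avoids halving. *)
Definition arcs (T : finType) (e : rel T) (A : {set T}) :=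
  \sum_(x in A) #|[set y in A | e x y]|.

Lemma arcs_le (T : finType) (e : rel T) (A : {set T}) : arcs e A <= #|A| * #|A|.
Proof.
rewrite -sum_nat_const; apply: leq_sum => x _; apply: subset_leq_card.
by apply/subsetP => y; rewrite inE => /andP[].
Qed.

Lemma arcsD1 (T : finType) (e : rel T) (A : {set T}) v :
  symmetric e -> irreflexive e -> v \in A ->
  arcs e A = arcs e (A :\ v) + (#|[set y in A | e v y]|).*2.
Proof.
move=> es ei vA; rewrite /arcs (big_setD1 v) //=.
have E x : x \in A :\ v ->
    #|[set y in A | e x y]| = #|[set y in A :\ v | e x y]| + e v x.
  move=> _; rewrite (cardsD1 v) inE vA es addnC; congr (_ + _).
  by apply: eq_card => y; rewrite !inE andbA.
rewrite (eq_bigr _ E) big_split /= -addnn addnC -addnA; congr (_ + (_ + _)).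
rewrite -big_mkcondr /= sum1dep_card; apply: eq_card => y; rewrite !inE.
by have [->|_] := eqVneq y v; rewrite ?ei ?andbF.
Qed.

(** A set maximizing [b * arcs e A - a * |A| ^ 2] has large minimum degree,
    since deleting a vertex of small degree would increase this quantity; it is
    itself large, since the maximum is at least the value at the full set. *)
Lemma dense_core (T : finType) (e : rel T) a b :
  symmetric e -> irreflexive e ->
  a * #|T| ^ 2 < b * arcs e setT ->
  exists A : {set T}, b * arcs e setT - a * #|T| ^ 2 <= b * #|A| ^ 2 /\
    {in A, forall v, a * (2 * #|A| - 1) <= b * (2 * #|[set y in A | e v y]|)}.
Proof.
move=> es ei lt; pose phi A := b * arcs e A - a * #|A| ^ 2.
have phiT : phi setT = b * arcs e setT - a * #|T| ^ 2 by rewrite /phi cardsT.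
pose A := [arg max_(A > [set: T]) phi A].
have Amax B : phi B <= phi A.
  by rewrite /A; case: arg_maxnP => // C _; apply.
exists A; split.
  rewrite -phiT; apply: leq_trans (Amax _) _; rewrite (leq_trans (leq_subr _ _)) //.
  by rewrite leq_mul2l -mulnn arcs_le orbT.
move=> v vA; have := Amax (A :\ v); have : 0 < phi A.
  by apply: leq_trans (Amax setT); rewrite phiT subn_gt0.
rewrite /phi (arcsD1 es ei vA) (cardsD1 v A) vA.
set d := #|_|; set m := #|_|; set w := arcs _ _.
rewrite add1n subn_gt0 -muln2 mulnDr.
have -> : a * m.+1 ^ 2 = a * m ^ 2 + a * (2 * m.+1 - 1).
  by rewrite -mulnDr; congr (_ * _); lia.
by rewrite (mulnC d); lia.
Qed.

(** The Erdos-Stone theorem for [K_(r+2)]: the hypothesis bounds the density of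
    [e] below by [(1 + 1 / K) (1 - 1 / (r + 1))], up to a linear term, so that it
    applies to any graph with [(1 + 1 / K)] times the edges of a balanced
    [(r + 1)]-partite one. *)
Lemma erdos_stone r K t : 0 < r -> 0 < K -> 0 < t ->
  exists n0, forall (T : finType) (e : rel T),
  symmetric e -> irreflexive e -> n0 <= #|T| ->
  K.+1 * (r * #|T| ^ 2) <= K * r.+1 * arcs e setT + K.+1 * r.+1 * #|T| ->
  blowup e r.+2 t setT.
Proof.
move=> r0 K0 t0.
have [||//|m0 m0P] := @blowup_min_degree r.+1 (8 * K) r.+2 t; [by []|by lia|].
(* a / b lies between the Turan density r / (r + 1) and the density of e, at
   distance at least 1 / b from both once n is large *)
pose a := 4 * K * r + 1; pose b := 4 * K * r.+1; pose M := m0 + a.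
exists (2 * K.+1 * r.+1 + b * M + 1) => T e es ei; set n := #|T| => nn dens.
have n_a : a * n ^ 2 + n ^ 2 <= b * arcs e setT.
  have E1 : 4 * (K.+1 * (r * n ^ 2)) <= b * arcs e setT + 4 * (K.+1 * r.+1) * n.
    by rewrite /b; move: dens; set X := arcs e setT; lia.
  have E2 : 4 * (K.+1 * r.+1) * n <= 2 * n ^ 2.
    by rewrite -mulnn (mulnA 2) leq_mul2r; apply/orP; right; lia.
  have E3 : n ^ 2 <= r * n ^ 2 by rewrite leq_pmull.
  by move: E1 E2 E3; rewrite /a; lia.
have n0 : 0 < n by lia.
have [|A [A_large A_deg]] := @dense_core T e a b es ei.
  by apply: leq_trans n_a; rewrite -addn1 leq_add2l expn_gt0 n0.
have MA : M <= #|A|.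
  rewrite leqNgt; apply/negP => AM.
  have E1 : n ^ 2 <= b * #|A| ^ 2 by move: A_large n_a; lia.
  have E2 : b * #|A| ^ 2 <= b * M ^ 2 by rewrite leq_mul2l leq_exp2r // ltnW ?orbT.
  have E3 : b * M ^ 2 <= (b * M) ^ 2.
    by rewrite expnMn leq_mul2r -{1}[b]expn1 leq_pexp2l ?orbT //; rewrite /b !muln_gt0 K0.
  have E4 : (b * M) ^ 2 < n ^ 2 by rewrite ltn_exp2r //; lia.
  by lia.
have [P [PA Pe]] : blowup e r.+2 t A.
  apply: m0P => //; first by move: MA; rewrite /M; lia.
  move=> v vA; have := A_deg v vA.
  have := cardsID [set y | e v y] A.
  have -> : A :&: [set y | e v y] = [set y in A | e v y] by apply/setP => y; rewrite !inE.
  have -> : A :\: [set y | e v y] = [set y in A | ~~ e v y].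
    by apply/setP => y; rewrite !inE andbC.
  set d := #|_|; set nd := #|_| => dE deg.
  have aA : a <= #|A| by move: MA; rewrite /M; lia.
  have E1 : 8 * K * r.+1 * #|A| = 8 * K * r.+1 * d + 8 * K * r.+1 * nd by rewrite -dE mulnDr.
  have E2 : a * (2 * #|A|) <= 8 * K * r.+1 * d + a.
    by move: deg; rewrite /b mulnBr muln1; lia.
  have E3 : (8 * K).-1 * #|A| + #|A| = 8 * K * #|A|.
    by rewrite addnC -mulSn prednK // muln_gt0.
  by move: E1 E2 E3 aA; rewrite /a; lia.
by exists P; split=> // i /PA[_ ->]; rewrite subsetT.
Qed.

(** * Separating inner colours from cross colours *)

Lemma set2_eq (T : finType) (x y x' y' : T) : [set x; y] = [set x'; y'] ->
  (x = x' /\ y = y') \/ (x = y' /\ y = x').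
Proof.
move=> E; move/setP: (E) => S.
have := S x; have := S y; have := S x'; have := S y'.
rewrite !inE !eqxx ?orbT /= => /orP[]/eqP e1 /orP[]/eqP e2 /esym/orP[]/eqP e3 /esym/orP[]/eqP e4;
  subst; auto.
Qed.

Lemma lines_meet x y x' y' j l : j != l ->
  x + j * y = x' + j * y' -> x + l * y = x' + l * y' -> x = x' /\ y = y'.
Proof.
wlog lt : j l / j < l => [W jl|_].
  move: (jl); rewrite neq_ltn => /orP[] lt E1 E2; first exact: (W j l).
  by apply: (W l j) => //; rewrite eq_sym.
have -> : l = j + (l - j) by lia.
rewrite !mulnDl !addnA => E1; rewrite E1 => /addnI/eqP.
rewrite eqn_pmul2l ?subn_gt0 // => /eqP yy; split=> //.
by move: E1; rewrite yy => /addIn.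
Qed.

(** In a large rainbow blow-up, an edge inside a part may repeat the colour of
    an edge between parts. Cut every part into blocks of size [t] and let part [i]
    use block number [x + i * y], with [x, y < m]. The edge between parts that
    conflicts with a given inner edge is unique, and its two blocks determine [x]
    and [y] (two points determine a line). So a bad [(x, y)] is determined by
    an inner edge: there are [O(m)] of them, out of [m ^ 2]. *)
Lemma conflict_free_blocks q t : exists L,
  forall (T : finType) (c : {set T} -> nat) (g : nat -> nat -> T),
  (forall i j a b, i < q -> j < q -> a < L -> b < L -> g i a = g j b -> i = j /\ a = b) ->
  (forall i j a b i' j' a' b', i < q -> j < q -> a < L -> b < L -> i != j ->
     i' < q -> j' < q -> a' < L -> b' < L -> i' != j' ->
     c [set g i a; g j b] = c [set g i' a'; g j' b'] ->
     [set g i a; g j b] = [set g i' a'; g j' b']) ->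
  exists o : nat -> nat, (forall i, i < q -> o i + t <= L) /\
    forall i u v j z l w, i < q -> j < q -> l < q -> u < t -> v < t -> z < t -> w < t ->
      u != v -> j != l ->
      c [set g i (o i + u); g i (o i + v)] != c [set g j (o j + z); g l (o l + w)].
Proof.
pose m := (q * q * (t * t)).+1; pose L := q * m * t.
exists L => T c g gI rb.
pose o (xy : 'I_m * 'I_m) i := (xy.1 + i * xy.2) * t.
have bL (xy : 'I_m * 'I_m) i : i < q -> xy.1 + i * xy.2 < q * m.
  case: xy => x y /= iq; have := ltn_ord x; have : i * y <= (q - 1) * m.
    by apply: leq_mul; [lia|exact: ltnW].
  have : q * m = (q - 1) * m + m by rewrite mulnBl mul1n subnK // leq_pmull //; lia.
  by lia.
have oL (xy : 'I_m * 'I_m) i u : i < q -> u < t -> o xy i + u < L.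
  move=> /(bL xy) lt ut; rewrite /o /L; apply: (@leq_trans ((xy.1 + i * xy.2).+1 * t)).
    by rewrite mulSn; lia.
  by rewrite leq_mul2r lt orbT.
have oL' (xy : 'I_m * 'I_m) i : i < q -> o xy i + t <= L.
  move=> /(bL xy) lt; rewrite /o /L; apply: (@leq_trans ((xy.1 + i * xy.2).+1 * t)).
    by rewrite mulSn addnC.
  by rewrite leq_mul2r lt orbT.
pose bad (xy : 'I_m * 'I_m) (d : 'I_q * 'I_t * 'I_t * ('I_q * 'I_t * 'I_q * 'I_t)) :=
  let: (i, u, v, (j, z, l, w)) := d in
  [&& u != v, j != l & c [set g i (o xy i + u); g i (o xy i + v)] ==
                       c [set g j (o xy j + z); g l (o xy l + w)]].
case: (boolP [exists xy, [forall d, ~~ bad xy d]]) => [/existsP[xy /forallP H]|].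
  exists (o xy); split=> [i /(oL' xy)//|i u v j z l w iq jq lq ut vt zt wt uv jl].
  have := H (Ordinal iq, Ordinal ut, Ordinal vt, (Ordinal jq, Ordinal zt, Ordinal lq, Ordinal wt)).
  by rewrite /bad -!val_eqE /= uv jl.
rewrite negb_exists => /forallP H; exfalso.
have /fin_all_exists[f fP] xy : exists d, bad xy d.
  by have := H xy; rewrite negb_forall => /existsP[d /negPn]; exists d.
(* the conflicting inner edge, without the edge between parts *)
pose code xy := let: (i, u, v, _) := f xy in (i, (Ordinal (bL xy i (ltn_ord i))), u, v).
have codeI : injective code.
  move=> xy xy'; have := fP xy; have := fP xy'; rewrite /code.
  case: (f xy) => [[[i u] v] [[[j z] l] w]]; case: (f xy') => [[[i' u'] v'] [[[j' z'] l'] w']].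
  move=> /and3P[uv' jl' /eqP E'] /and3P[uv jl /eqP E] [ii bb uu vv].
  rewrite -ii -uu -vv in E'.
  have oo : o xy i = o xy' i by rewrite /o bb ii.
  rewrite -oo E in E'; have /set2_eq S : [set g j (o xy j + z); g l (o xy l + w)] =
     [set g j' (o xy' j' + z'); g l' (o xy' l' + w')] by apply: rb => //; apply: oL.
  have key (j1 j2 z1 z2 : nat) : z1 < t -> z2 < t -> j1 < q -> j2 < q ->
      g j1 (o xy j1 + z1) = g j2 (o xy' j2 + z2) ->
      xy.1 + j1 * xy.2 = xy'.1 + j1 * xy'.2.
    move=> z1t z2t j1q j2q /gI[]; rewrite ?oL // => -> /eqP.
    rewrite /o => /eqP/(congr1 (divn^~ t)).
    by rewrite !divnMDl ?(divn_small z1t) ?(divn_small z2t) ?addn0 //; lia.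
  have [K1 K2] : xy.1 + j * xy.2 = xy'.1 + j * xy'.2 /\ xy.1 + l * xy.2 = xy'.1 + l * xy'.2.
    by case: S => -[S1 S2]; split; [exact: key S1|exact: key S2|exact: key S1|exact: key S2].
  have [e1 e2] := lines_meet jl K1 K2.
  by apply/eqP; rewrite -pair_eqE /= -!val_eqE /= e1 e2 !eqxx.
have := leq_card code codeI; rewrite !card_prod !card_ord.
apply/negP; rewrite -ltnNge {3}/m.
rewrite (_ : q * (q * m) * t * t = m * (q * q * (t * t))); last by ring.
by rewrite ltn_pmul2l.
Qed.

(** * Selecting the vertices of a copy *)

(** The edges of [K_(k+1)] and [K_k] together: the only source of squares greater
    than [1] below. *)
Lemma bin2_consecutive k : 'C(k.+1, 2) + 'C(k, 2) = k ^ 2.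
Proof.
have step n : 'C(n.+1, 2) = 'C(n, 2) + n by rewrite binS bin1.
by elim: k => // k IH; rewrite step; move: IH (step k); lia.
Qed.

Section Selection.
Variables (T : finType) (c : {set T} -> nat) (q : nat) (B : 'I_q -> {set T}).
Hypothesis cross_rainbow : forall i j x y i' j' x' y', i != j -> i' != j' ->
  x \in B i -> y \in B j -> x' \in B i' -> y' \in B j' ->
  c [set x; y] = c [set x'; y'] -> [set x; y] = [set x'; y'].
Hypothesis inner_neq_cross : forall i x y j l z w, j != l ->
  x \in B i -> y \in B i -> x != y -> z \in B j -> w \in B l ->
  c [set x; y] != c [set z; w].

Definition inner (e : {set T}) := [exists i, e \subset B i].

(** The colours of cross edges occur once and not on inner edges, so only the
    inner edges of [X] can spoil it. *)
Lemma square_classes_of_inner (X : {set T}) : X \subset \bigcup_i B i ->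
  (forall a : nat, exists k, #|[set e in pairs X | inner e & c e == a]| = k ^ 2) ->
  forall a : nat, exists k, #|[set e in pairs X | c e == a]| = k ^ 2.
Proof.
move=> XB H a.
have cross e : e \in pairs X -> ~~ inner e -> exists i j x y,
    [/\ i != j, x \in B i, y \in B j & e = [set x; y]].
  case/pairsP => x [y [xX yX xy ->]] nin.
  have /bigcupP[i _ xi] := subsetP XB x xX; have /bigcupP[j _ yj] := subsetP XB y yX.
  exists i, j, x, y; split=> //; apply: contra nin => /eqP ij; apply/existsP; exists i.
  by rewrite subUset !sub1set xi ij yj.
case: (boolP [exists e in pairs X, inner e && (c e == a)]).
  case/existsP => e0 /and3P[e0X /existsP[i e0i] /eqP e0a].
  case: (H a) => k Hk; exists k; rewrite -Hk; apply: eq_card => e; rewrite in_set [RHS]in_set.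
  case: (boolP (e \in pairs X)) => //= eX; case: (altP (c e =P a)) => [ea|]; last by rewrite andbF.
  rewrite andbT; apply/esym; apply: contraT => nin.
  have [j [l [z [w [jl zj wl ee]]]]] := cross e eX nin.
  have /pairsP[x [y [_ _ xy e0E]]] := e0X.
  have := @inner_neq_cross i x y j l z w jl.
  move: e0i; rewrite e0E subUset !sub1set => /andP[xi yi] /(_ xi yi xy zj wl).
  by rewrite -e0E -ee e0a ea eqxx.
rewrite negb_exists => /forallP nin.
have le1 : #|[set e in pairs X | c e == a]| <= 1.
  apply/card_le1_eqP => e e'; rewrite in_set [e' \in _]in_set => /andP[eX /eqP ea] /andP[e'X /eqP e'a].
  have := nin e; rewrite eX ea eqxx andbT => /(cross e eX)[i [j [x [y [ij xi yj eE]]]]].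
  have := nin e'; rewrite e'X e'a eqxx andbT => /(cross e' e'X)[i' [j' [x' [y' [ij' xi' yj' eE']]]]].
  move: e'a; rewrite -ea eE eE'; exact: (cross_rainbow ij' ij xi' yj' xi yj).
by exists #|[set e in pairs X | c e == a]|; case: #|_| le1 => [|[]].
Qed.

Hypothesis disj : forall i j x, x \in B i -> x \in B j -> i = j.

Lemma inner_pairsE (X e : {set T}) :
  (e \in pairs X) && inner e = [exists i, e \in pairs (X :&: B i)].
Proof.
apply/idP/existsP => [/andP[eX /existsP[i ei]]|[i]]; last first.
  rewrite !inE subsetI => /andP[/andP[-> ei] ->] /=; apply/existsP; exists i.
  by [].
by exists i; move: eX; rewrite !inE subsetI ei andbT.
Qed.

(** With one edge of its own colour in each part, everything is rainbow. *)
Lemma matching_selection (f : 'I_q -> {set T}) p :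
  p <= q.*2 -> injective (c \o f) -> (forall i, f i \in pairs (B i)) ->
  exists2 X : {set T}, #|X| = p &
    forall a : nat, exists k, #|[set e in pairs X | c e == a]| = k ^ 2.
Proof.
move=> pq fI fB.
have fB' i : f i \subset B i by have := fB i; rewrite inE => /andP[].
have f2 i : #|f i| = 2 by have := fB i; rewrite inE => /andP[_ /eqP].
pose U := \bigcup_i f i.
have cU : #|U| = q.*2.
  have -> : U = cover [set f i | i : 'I_q] by rewrite cover_imset.
  have /eqP <- : trivIset [set f i | i : 'I_q].
    apply/trivIsetP => A A' /imsetP[i _ ->] /imsetP[j _ ->] ij.
    rewrite -setI_eq0; apply: contraNT ij => /set0Pn[x /setIP[xi xj]].
    by rewrite (disj (subsetP (fB' i) x xi) (subsetP (fB' j) x xj)).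
  rewrite big_imset /=; last by move=> i j _ _ E; apply: fI; rewrite /= E.
  by rewrite (eq_bigr (fun=> 2)) // sum_nat_const card_ord muln2.
exists (take_set p U); first by rewrite card_take_set ?cU.
have XU : take_set p U \subset U := take_set_sub _ _.
apply: square_classes_of_inner.
  apply: subset_trans XU _; apply/bigcupsP => i _.
  exact: subset_trans (fB' i) (bigcup_sup i _).
move=> a; set S := [set _ in _ | _ & _].
have Sf e : e \in S -> exists2 i, e = f i & c (f i) = a.
  rewrite in_set andbA inner_pairsE => /andP[/existsP[i]].
  rewrite inE subsetI -andbA => /and3P[eX ei /eqP e2] /eqP ea.
  have ef : e = f i.
    apply/eqP; rewrite eqEcard e2 f2 leqnn andbT; apply/subsetP => x xe.
    have /bigcupP[j _ xj] := subsetP XU x (subsetP eX x xe).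
    by rewrite (disj (subsetP ei x xe) (subsetP (fB' j) x xj)).
  by exists i; rewrite -?ef.
have le1 : #|S| <= 1.
  apply/card_le1_eqP => e e' /Sf[i -> ci] /Sf[j -> cj]; congr f.
  by apply: fI; rewrite /= ci cj.
by exists #|S|; case: #|S| le1 => [|[]].
Qed.

Lemma pairs_inter (Y Z : {set T}) e : e \in pairs Y -> e \in pairs Z -> e \in pairs (Y :&: Z).
Proof. by rewrite !inE subsetI => /andP[-> ->] /andP[->]. Qed.

(** Two monochromatic parts of the same colour, taken with [k + 1] and [k]
    vertices, give a class of [k ^ 2] edges. A further vertex [Z] from a third part
    adjusts the parity of the order without adding inner edges. *)
Lemma monochromatic_selection i j l (K1 K2 Z : {set T}) a k :
  i != j -> i != l -> j != l ->
  K1 \subset B i -> K2 \subset B j -> Z \subset B l ->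
  #|K1| = k.+1 -> #|K2| = k -> #|Z| <= 1 ->
  {in pairs K1, forall e, c e = a} -> {in pairs K2, forall e, c e = a} ->
  exists2 X : {set T}, #|X| = k.*2.+1 + #|Z| &
    forall b : nat, exists s, #|[set e in pairs X | c e == b]| = s ^ 2.
Proof.
move=> ij il jl K1B K2B ZB k1 k2 z1 m1 m2.
have dis (i1 i2 : 'I_q) (Y1 Y2 : {set T}) : i1 != i2 -> Y1 \subset B i1 -> Y2 \subset B i2 ->
    Y1 :&: Y2 = set0.
  move=> i12 YB1 YB2; apply/eqP; rewrite setI_eq0; apply/pred0P => x /=.
  apply/negP => /andP[x1 x2]; case/eqP: i12.
  exact: disj (subsetP YB1 x x1) (subsetP YB2 x x2).
pose X := K1 :|: K2 :|: Z; exists X.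
  rewrite /X cardsU cardsU (dis i j) // cards0 subn0 setIUl (dis i l) // (dis j l) //.
  by rewrite setU0 cards0 subn0 k1 k2; lia.
have XB : X \subset \bigcup_i B i.
  by rewrite !subUset !(bigcup_max _ _ K1B, bigcup_max _ _ K2B, bigcup_max _ _ ZB).
have XBE h : h \in [:: i; j; l] \/ X :&: B h = set0.
  case: (boolP (h \in _)) => hN; [by left|right].
  by move: hN; rewrite !inE !negb_or => /and3P[hi hj hl]; rewrite /X !setIUl
    (dis i h) // 1?eq_sym // (dis j h) // 1?eq_sym // (dis l h) // 1?eq_sym // !setU0.
apply: square_classes_of_inner XB _ => b.
have innerE e : (e \in pairs X) && inner e = (e \in pairs K1) || (e \in pairs K2).
  rewrite inner_pairsE; apply/existsP/orP => [[h]|[eK|eK]].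
  - case/pairsP => x [y [/setIP[xX xh] /setIP[yX yh] xy ->]].
    rewrite !in_setU in xX yX.
    have loc (x' : T) : (x' \in K1) || (x' \in K2) || (x' \in Z) -> x' \in B h ->
        [|| (x' \in K1) && (h == i), (x' \in K2) && (h == j) | (x' \in Z) && (h == l)].
      move=> /orP[/orP[]|] x'K x'h; rewrite x'K /=.
      + by rewrite (disj (subsetP K1B _ x'K) x'h) eqxx.
      + by rewrite (disj (subsetP K2B _ x'K) x'h) eqxx orbT.
      + by rewrite (disj (subsetP ZB _ x'K) x'h) eqxx !orbT.
    have P12 (K : {set T}) : x \in K -> y \in K -> [set x; y] \in pairs K.
      by move=> xK yK; apply/pairsP; exists x, y.
    move: (loc x xX xh) (loc y yX yh) => /or3P[]/andP[xK /eqP hx] /or3P[]/andP[yK /eqP hy];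
      try by move: ij il jl; rewrite -hx -hy !eqxx.
    + by left; apply: P12.
    + by right; apply: P12.
    + by move: z1 => /card_le1_eqP/(_ x y xK yK) exy; rewrite exy eqxx in xy.
  - exists i; apply: (subsetP (pairsS _)) eK; rewrite subsetI K1B /X -setUA subsetUl //.
  - exists j; apply: (subsetP (pairsS _)) eK; rewrite subsetI K2B /X setUAC subsetUr //.
have SE : [set e in pairs X | inner e & c e == b] =
          if a == b then pairs K1 :|: pairs K2 else set0.
  apply/setP => e; rewrite in_set andbA innerE.
  have ca : (e \in pairs K1) || (e \in pairs K2) -> c e = a by case/orP => [/m1|/m2].
  case: ifP => ab; rewrite ?in_setU ?in_set0; case: (boolP (_ || _)) => //= /ca ->;
  by rewrite ab.
rewrite SE; case: ifP => _; last by exists 0; rewrite cards0.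
exists k; rewrite cardsU !card_pairs k1 k2.
have -> : pairs K1 :&: pairs K2 = set0.
  apply/setP => e; rewrite in_set0; apply/negP => /setIP[/pairs_inter h1 /h1].
  by rewrite (dis i j) // => /pairsP[x [y []]]; rewrite inE.
by rewrite cards0 subn0 bin2_consecutive.
Qed.

End Selection.

(** Distinct representatives where the indices in [few] are already served by
    [a0]. The other ones are served in turn, each avoiding the at most [q] current
    values, including those of the indices that are yet to be served. *)
Lemma distinct_representatives q (C : 'I_q -> seq nat) (few : pred 'I_q) (a0 : 'I_q -> nat) :
  (forall i, few i -> a0 i \in C i) -> {in few &, injective a0} ->
  (forall i, ~~ few i -> uniq (C i) /\ q < size (C i)) ->
  exists2 a : 'I_q -> nat, injective a & forall i, a i \in C i.
Proof.
move=> fewC a0I manyC.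
pose D s := [pred i : 'I_q | few i || (i < s)].
have H s : s <= q -> exists2 a : 'I_q -> nat,
    {in D s &, injective a} & {in D s, forall i, a i \in C i}.
  elim: s => [_|s IH sq].
    by exists a0 => [i j|i]; rewrite !inE ?ltn0 ?orbF; [apply: a0I|apply: fewC].
  have [a aI aC] := IH (ltnW sq); pose i0 := Ordinal sq.
  have DS i : i \in D s.+1 -> i != i0 -> i \in D s.
    by rewrite !inE ltnS leq_eqVlt -val_eqE /=; case: eqP.
  case: (boolP (few i0)) => [fi|/manyC[Cu Cs]].
    have {}DS i : i \in D s.+1 -> i \in D s.
      by have [->|/DS//] := eqVneq i i0; rewrite !inE fi.
    by exists a => [i j /DS iD /DS jD|i /DS]; [apply: aI|apply: aC].
  have /allPn[b bC bN] : ~~ all (mem [seq a j | j : 'I_q]) (C i0).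
    apply/negP => /allP sub; have := uniq_leq_size Cu sub.
    by rewrite size_map -cardE card_ord leqNgt Cs.
  have aN j : a j != b by apply: contraNneq bN => <-; apply/codomP; exists j.
  exists (fun i => if i == i0 then b else a i) => [i j|i] iD; last first.
    by case: eqVneq => [->//|/(DS _ iD)/aC].
  move=> jD; case: (eqVneq i i0) => [->|ii]; case: (eqVneq j i0) => [->|jj] //.
  - by move/esym/eqP; rewrite (negbTE (aN _)).
  - by move/eqP; rewrite (negbTE (aN _)).
  - by apply: aI; apply: DS.
have [a aI aC] := H q (leqnn q).
by exists a => [i j|i]; [apply: aI|apply: aC]; rewrite inE ltn_ord orbT.
Qed.

(** * Multipartite graphs and Turan's theorem *)

Definition cross_edges (T : finType) (col : T -> nat) : {set {set T}} :=
  [set e in pairs setT | [exists x in e, [exists y in e, col x != col y]]].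

Lemma mem_cross_edges (T : finType) (col : T -> nat) x y :
  ([set x; y] \in cross_edges col) = (col x != col y).
Proof.
rewrite in_set; apply/andP/idP => [[_]|xy].
  case/existsP => a /andP[aS /existsP[b /andP[]]].
  move: aS; rewrite !inE => /orP[]/eqP-> /orP[]/eqP->; rewrite ?eqxx // eq_sym //.
split.
  by apply/pairsP; exists x, y; split; rewrite ?inE //; apply: contraNneq xy => ->.
by apply/existsP; exists x; rewrite !inE eqxx; apply/existsP; exists y; rewrite !inE eqxx orbT.
Qed.

Lemma cross_edges_sub (T : finType) (col : T -> nat) : cross_edges col \subset pairs setT.
Proof. by apply/subsetP => e; rewrite in_set => /andP[]. Qed.

Lemma cross_edges_clique_free (T : finType) (col : T -> nat) r :
  (forall x, col x < r) -> ~~ has_copy (complete r.+1) (cross_edges col).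
Proof.
move=> colr; apply/has_copy_completeP => -[h hI hE].
have fI : injective (fun i => Ordinal (colr (h i))).
  move=> i j [] cE; apply/eqP; apply: contraT => ij.
  by have := hE i j ij; rewrite mem_cross_edges cE eqxx.
by have := leq_card _ fI; rewrite !card_ord ltnn.
Qed.

Lemma turan_ex_ge n F (E : {set {set 'I_n}}) :
  E \subset pairs setT -> ~~ has_copy F E -> #|E| <= turan_ex n F.
Proof.
move=> sE nF; apply: (@leq_bigmax_cond _ _ (fun E : {set {set 'I_n}} => #|E|)).
by rewrite edges_completeE sE.
Qed.

(** [ex(n, K_(r+2))] is at least the number of edges of the balanced complete
    [(r + 1)]-partite graph, where vertices are sorted modulo [r + 1]. *)
Lemma turan_ex_balanced n r :
  r * n ^ 2 <= 2 * r.+1 * turan_ex n (complete r.+2) + r.+1 * n.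
Proof.
pose col (x : 'I_n) := x %% r.+1.
have le : #|cross_edges col| <= turan_ex n (complete r.+2).
  apply: turan_ex_ge; first exact: cross_edges_sub.
  by apply: cross_edges_clique_free => x; rewrite ltn_mod.
have same x : #|[set y | col y == col x]| <= (n %/ r.+1).+1.
  pose f (y : 'I_n) : 'I_(n %/ r.+1).+1 := inord (y %/ r.+1).
  have fE (y : 'I_n) : f y = y %/ r.+1 :> nat.
    by rewrite inordK // ltnS leq_div2r // ltnW.
  rewrite -[leqRHS]card_ord -(@card_in_imset _ _ f) ?max_card // => y z.
  rewrite !inE => /eqP cy /eqP cz /(congr1 val); rewrite /= !fE => d.
  by apply: val_inj; rewrite /= (divn_eq y r.+1) (divn_eq z r.+1) d -/(col y) -/(col z) cy cz.
have := handshake (cross_edges_sub col).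
have degE x : n - (n %/ r.+1).+1 <= #|[set y | [set x; y] \in cross_edges col]|.
  rewrite leq_subLR -{1}[n]card_ord -cardsT -(cardsID [set y | col y == col x]) leq_add //.
    by rewrite setTI same.
  apply: subset_leq_card; apply/subsetP => y /setDP[_ yc].
  by rewrite in_set mem_cross_edges eq_sym; rewrite in_set in yc.
have : n * (n - (n %/ r.+1).+1) <= \sum_(x < n) #|[set y | [set x; y] \in cross_edges col]|.
  by rewrite -[X in X * _]card_ord -sum_nat_const; apply: leq_sum.
move=> + hs; rewrite hs => dens.
have dn : r.+1 * (n %/ r.+1) <= n by rewrite mulnC leq_trunc_div.
have E1 : n * n <= n * (n - (n %/ r.+1).+1) + n * (n %/ r.+1).+1.
  by rewrite -mulnDr leq_mul2l; apply/orP; right; lia.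
have E2 : r.+1 * (n * n) <= r.+1 * (2 * turan_ex n (complete r.+2)) + n * (r.+1 * (n %/ r.+1)) + r.+1 * n.
  apply: leq_trans (leq_mul (leqnn r.+1) E1) _; rewrite mulnDr -addnA leq_add //.
    by rewrite leq_mul2l /= (leq_trans dens) // -muln2 mulnC leq_mul2l.
  by apply: eq_leq; ring.
have E3 : n * (r.+1 * (n %/ r.+1)) <= n * n by rewrite leq_mul2l dn orbT.
by rewrite mulSn in E2; rewrite -mulnn; lia.
Qed.

(** Erdos's proof of Turan's theorem: a [K_(r+1)]-free graph is dominated in
    degrees by an [r]-partite one. Let [v] have maximum degree; its neighbourhood
    [N] is [K_r]-free and is handled by induction, and the vertices outside [N]
    form one more class. Their new degree is [|N|], the maximum, and the vertices
    in [N] become adjacent to everything outside [N]. *)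
Lemma degree_majorization r (T : finType) (e : rel T) (A : {set T}) :
  symmetric e -> irreflexive e ->
  (forall K : {set T}, K \subset A -> #|K| = r.+1 ->
     exists x y, [/\ x \in K, y \in K, x != y & ~~ e x y]) ->
  exists col : T -> nat, forall x, x \in A ->
    col x < r /\ #|[set y in A | e x y]| <= #|[set y in A | col x != col y]|.
Proof.
move=> es ei; elim: r A => [|r IH] A free.
  exists (fun=> 0) => x xA; exfalso.
  have [||y [z [/set1P-> /set1P->]]] := free [set x]; rewrite ?sub1set ?cards1 //.
  by rewrite eqxx.
have [->|[v0 v0A]] := set_0Vmem A; first by exists (fun=> 0) => x; rewrite inE.
pose deg x := #|[set y in A | e x y]|.
case: (arg_maxnP deg v0A) => v vmem vmax; have vA : v \in A := vmem; pose N := [set y in A | e v y].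
have NA : N \subset A by apply/subsetP => y; rewrite inE => /andP[].
have [K KN Kr|col colP] := IH N.
  have vK : v \notin K by apply/negP => /(subsetP KN); rewrite inE ei andbF.
  have [||x [y []]] := free (v |: K).
  - by rewrite subUset sub1set vA (subset_trans KN NA).
  - by rewrite cardsU1 vK Kr.
  have ve z : z \in K -> e v z by move/(subsetP KN); rewrite inE => /andP[].
  move=> /setU1P[->|xK] /setU1P[->|yK] xy nxy; first by rewrite eqxx in xy.
  - by rewrite ve in nxy.
  - by rewrite es ve in nxy.
  - by exists x, y.
exists (fun x => if x \in N then col x else r) => x xA.
case: ifP => [xN|xN]; last first.
  split=> //; apply: leq_trans (vmax x xA) _; apply: subset_leq_card.
  apply/subsetP => y yN; have [yr _] := colP y yN.
  by rewrite inE (subsetP NA) //= yN gtn_eqF.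
have [xr le] := colP x xN; split; first exact: ltnW.
rewrite -(cardsID N) -[leqRHS](cardsID N) leq_add //.
  apply: leq_trans (_ : _ <= #|[set y in N | e x y]|) _.
    apply: subset_leq_card; apply/subsetP => y /setIP[yA yN].
    by rewrite in_set in yA; rewrite in_set yN; case/andP: yA.
  apply: leq_trans le _; apply: subset_leq_card; apply/subsetP => y.
  rewrite in_set => /andP[yN cy]; rewrite in_setI in_set yN (subsetP NA) //= andbT.
  exact: cy.
apply: subset_leq_card; apply/subsetP => y /setDP[yA yN].
rewrite in_setD yN in_set (negbTE yN) (ltn_eqF xr) andbT /=.
by rewrite in_set in yA; case/andP: yA.
Qed.

(** The multipartite form of Turan's theorem is what the lower bound needs: the
    colouring is built on the classes of [col]. *)
Lemma turan_ex_le n r : exists col : 'I_n -> nat,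
  (forall x, col x < r.+1) /\ turan_ex n (complete r.+2) <= #|cross_edges col|.
Proof.
pose free := [pred E : {set {set 'I_n}} |
  (E \subset edges (complete n)) && ~~ has_copy (complete r.+2) E].
have free0 : 0 < #|free|.
  apply/card_gt0P; exists set0; rewrite inE sub0set /=.
  apply/has_copy_completeP => -[h _ /(_ ord0 ord_max)]; rewrite inE.
  by move=> /(_ isT).
have [E] := eq_bigmax_cond (fun E : {set {set 'I_n}} => #|E|) free0.
rewrite inE edges_completeE => /andP[sE nE] exE.
pose e := [rel x y : 'I_n | [set x; y] \in E].
have es : symmetric e by move=> x y; rewrite /= setUC.
have ei : irreflexive e.
  move=> x; apply/negP => /(subsetP sE); rewrite setUid inE cards1 andbF //.
have [|col colP] := @degree_majorization r.+1 _ e setT es ei.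
  move=> K _ Kr; case: (boolP [exists x in K, exists y in K, (x != y) && ~~ e x y]).
    by case/existsP => x /andP[xK /existsP[y /and3P[yK xy nxy]]]; exists x, y.
  rewrite negb_exists => /forallP H; case/has_copy_completeP: nE.
  exists (fun i => enum_val (cast_ord (esym Kr) i)) => [i j|i j ij].
    by move=> /enum_val_inj /cast_ord_inj.
  have := H (enum_val (cast_ord (esym Kr) i)); rewrite enum_valP negb_exists /=.
  move=> /forallP/(_ (enum_val (cast_ord (esym Kr) j))); rewrite enum_valP /=.
  by rewrite (inj_eq enum_val_inj) (inj_eq (@cast_ord_inj _ _ _)) ij negbK.
exists col; split=> [x|]; first by case: (colP x (in_setT x)).
rewrite [turan_ex _ _]exE -leq_double -!handshake ?cross_edges_sub //.
apply: leq_sum => x _; have [_ le] := colP x (in_setT x).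
apply: leq_trans (leq_trans _ le) _; apply: subset_leq_card; apply/subsetP => y.
  by rewrite !in_set.
by rewrite [_ \in [set y | [set x; y] \in _]]in_set mem_cross_edges !in_set.
Qed.

(** * Lower bound *)

(** Edges between classes get private colours [>= n]; inside a class, an edge gets
    its larger endpoint as its colour, so that the colour classes of a clique are
    stars with [0, 1, 2, ...] edges. *)
Definition star_coloring n (col : 'I_n -> nat) (e : {set 'I_n}) : nat :=
  if e \in cross_edges col then n + enum_rank e else \max_(x in e) x.

Lemma star_coloring_inner n (col : 'I_n -> nat) (x y : 'I_n) :
  col x = col y -> x < y -> star_coloring col [set x; y] = y.
Proof.
move=> cxy xy; rewrite /star_coloring mem_cross_edges cxy eqxx /=.
rewrite big_setU1 ?inE /=; last by rewrite -val_eqE /= ltn_eqF.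
by rewrite big_set1 (maxn_idPr _) // ltnW.
Qed.

Lemma star_coloring_size n (col : 'I_n -> nat) :
  #|cross_edges col| <= size (colors_on (star_coloring col) (edges (complete n))).
Proof.
rewrite cardE -(size_map (star_coloring col)) uniq_leq_size //.
  rewrite map_inj_in_uniq ?enum_uniq // => e e'; rewrite !mem_enum /star_coloring => -> ->.
  by move=> /addnI /val_inj /enum_rank_inj.
move=> a /mapP[e]; rewrite mem_enum => eX ->; rewrite mem_undup.
apply/mapP; exists e => //; rewrite mem_enum edges_completeE.
exact: subsetP (cross_edges_sub _) e eX.
Qed.

Lemma third_smallest n (Y : {set 'I_n}) : 2 < #|Y| ->
  exists v, v \in Y /\ #|[set y in Y | y < v]| = 2.
Proof.
have min_out (Z : {set 'I_n}) : 0 < #|Z| -> exists2 w, w \in Z & forall z, z \in Z -> w <= z.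
  by case/card_gt0P => z zZ; case: (arg_minnP val zZ) => w wZ H; exists w.
move=> Y2; have [|w1 w1Y m1] := min_out Y; first by lia.
have c1 := cardsD1 w1 Y; rewrite w1Y in c1.
have [|w2 w2Y m2] := min_out (Y :\ w1); first by lia.
have c2 := cardsD1 w2 (Y :\ w1); rewrite w2Y in c2.
have [|v vY m3] := min_out (Y :\ w1 :\ w2); first by lia.
move: (vY) (w2Y); rewrite !in_setD1 => /and3P[v2 v1 vY'] /andP[w21 w2Y'].
exists v; split=> //.
have -> : [set y in Y | y < v] = [set w1; w2]; last by rewrite cards2 eq_sym w21.
apply/setP => y; rewrite in_set in_set2; apply/andP/orP => [[yY yv]|[]/eqP->].
- have [_|y1] := eqVneq y w1; first by left.
  have [_|y2] := eqVneq y w2; first by right.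
  by have := m3 y; rewrite !in_setD1 y1 y2 yY => /(_ isT); rewrite leqNgt yv.
- by rewrite w1Y ltn_neqAle val_eqE eq_sym v1 m1.
- by rewrite w2Y' ltn_neqAle val_eqE eq_sym v2 m2 // in_setD1 v1.
Qed.

(** Among more than [2 r] vertices, three lie in one class; the star at the third
    smallest vertex of that class has exactly [2] edges, not a square. *)
Lemma star_coloring_avoids n r p (col : 'I_n -> nat) :
  (forall x, col x < r) -> r.*2 < p ->
  ~ classes_copy (complete p) square_graphs (star_coloring col).
Proof.
move=> colr rp /classes_copyP[X Xp H].
have [||b br lt] := @pigeonhole_nat _ col X r 2; [by move=> x _|by rewrite muln2 Xp|].
have [v [vY gt2]] := third_smallest lt.
move: vY; rewrite in_set => /andP[vX /eqP vb].
have vn := ltn_ord v.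
have cE : [set e in pairs X | star_coloring col e == v] =
          [set [set v; y] | y in [set y in [set x in X | col x == b] | y < v]].
  apply/setP => e; rewrite in_set; apply/andP/imsetP => [[/pairsP[x [y [xX yX xy ->]]]]|[y]].
    wlog xy' : x y xX yX xy / x < y => [W|].
      move: (xy); rewrite -val_eqE neq_ltn => /orP[] lt'; first exact: W.
      by rewrite setUC; apply: W; rewrite // eq_sym.
    have [cxy|cxy] := eqVneq (col x) (col y).
      rewrite star_coloring_inner // => /eqP /val_inj yv; exists x; rewrite -?yv 1?setUC //.
      by rewrite !in_set xX cxy yv vb eqxx -yv.
    rewrite /star_coloring mem_cross_edges cxy => /eqP E.
    by rewrite -E ltnNge leq_addr in vn.
  case/setIdP => /setIdP[yX /eqP yb] yv ->; split.
    by apply/pairsP; exists v, y; split=> //; rewrite -val_eqE gtn_eqF.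
  by rewrite setUC star_coloring_inner // vb.
case: (H v) => k; rewrite cE card_in_imset ?gt2; last first.
  move=> y z; rewrite !in_set => /andP[_ yv] /andP[_ zv] /set2_eq[[]//|[vz' _]].
  by rewrite vz' ltnn in zv.
by case: k => [|[|k]] //; rewrite -mulnn; lia.
Qed.

Lemma not_forces_turan_ex n p m : 4 < p ->
  m <= turan_ex n (complete (uphalf p)) -> ~ forces n (complete p) square_graphs m.
Proof.
move=> p5 mex F.
have [r pr] : exists r, uphalf p = r.+2 by exists (uphalf p).-2; lia.
have [col [colr le]] := turan_ex_le n r.
apply: (star_coloring_avoids (p := p) colr); first by lia.
apply: F; apply: leq_trans (star_coloring_size _).
by rewrite (leq_trans mex) // pr.
Qed.

(** * Upper bound *)

(** Erdos-Stone and the removal of conflicts provide [q] parts whose cross edges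
    have private colours. By Ramsey, each part is rich in colours or contains a
    monochromatic clique. If two parts have cliques of the same colour,
    [monochromatic_selection] applies; otherwise distinct colours can be found in
    all parts, for [matching_selection]. *)
Lemma forces_above_turan_ex p K : 4 < p -> 0 < K -> exists n0, forall n m, n0 <= n ->
  K.+1 * turan_ex n (complete (uphalf p)) <= K * m ->
  forces n (complete p) square_graphs m.
Proof.
move=> p5 K0.
have [r r0 qr] : exists2 r, 0 < r & uphalf p = r.+2 by exists (uphalf p).-2; lia.
pose q := r.+2; pose k := p.-1./2.
(* the two cliques cover all of the p vertices when p is odd, and all but one
   otherwise *)
have pk : p = k.*2.+1 + ~~ odd p by rewrite /k; lia.
have k0 : 0 < k by rewrite /k; lia.
have [t tP] := ramsey q k.+1.
have [L LP] := conflict_free_blocks q t.+1.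
have [n0 n0P] := erdos_stone r0 K0 (ltn0Sn L).
exists n0 => n m nn; rewrite qr => mK c mc; apply/classes_copyP.
have [E [sE cE Em]] := rainbow_repr c (edges (complete n)).
rewrite edges_completeE in sE.
have {mc}Em : m <= #|E| := leq_trans mc Em.
pose e := [rel x y : 'I_n | [set x; y] \in E].
have es : symmetric e by move=> x y; rewrite /= setUC.
have ei : irreflexive e.
  by move=> x; apply/negP => /(subsetP sE); rewrite setUid inE cards1 andbF.
have arcsE : arcs e setT = #|E|.*2.
  rewrite -handshake //; apply: eq_big => x; first by rewrite inE.
  by move=> _; apply: eq_card => y; rewrite !in_set.
have [||P [PL Pe]] := n0P _ e es ei; rewrite ?card_ord //.
  rewrite arcsE; have := turan_ex_balanced n r; set x := turan_ex n _ in mK * => bal.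
  have E1 : K.+1 * (r * n ^ 2) <= K.+1 * (2 * r.+1 * x + r.+1 * n) by rewrite leq_mul2l bal orbT.
  have E2 : 2 * r.+1 * (K.+1 * x) <= 2 * r.+1 * (K * #|E|).
    by rewrite leq_mul2l (leq_trans mK) ?orbT // leq_mul2l Em orbT.
  apply: leq_trans E1 _; rewrite mulnDr mulnA leq_add ?mulnA //.
  by move: E2; rewrite -muln2 => E2; apply: leq_trans (leq_trans _ E2) _; apply: eq_leq; ring.
have /card_gt0P[x0 _] : 0 < #|P 0| by rewrite (PL 0 _).2.
pose g i a := nth x0 (enum (P i)) a.
have gP i a : i < q -> a < L -> g i a \in P i.
  by move=> iq aL; rewrite -mem_enum mem_nth // -cardE (PL i iq).2 leqW.
have PD i j x : i < q -> j < q -> x \in P i -> x \in P j -> i = j.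
  move=> iq jq xi xj; apply/eqP; apply: contraT => ij.
  by have := Pe i j x x iq jq ij xi xj; rewrite ei.
have gI i j a b : i < q -> j < q -> a < L -> b < L -> g i a = g j b -> i = j /\ a = b.
  move=> iq jq aL bL gg; have ij : i = j.
    by apply: (PD i j (g i a)); rewrite ?gP // gg gP.
  subst j; split=> //; apply/eqP; rewrite -(nth_uniq x0 _ _ (enum_uniq (P i))).
  - exact/eqP.
  - by rewrite -cardE (PL i iq).2 leqW.
  - by rewrite -cardE (PL i iq).2 leqW.
have Pc i j x y i' j' x' y' : i < q -> j < q -> i' < q -> j' < q -> i != j -> i' != j' ->
    x \in P i -> y \in P j -> x' \in P i' -> y' \in P j' ->
    c [set x; y] = c [set x'; y'] -> [set x; y] = [set x'; y'].
  move=> iq jq iq' jq' ij ij' xi yj xi' yj'; apply: cE.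
    exact: Pe ij xi yj.
  exact: Pe ij' xi' yj'.
have [|o [oL oP]] := LP _ c g gI.
  move=> i j a b i' j' a' b' iq jq aL bL ij iq' jq' aL' bL' ij'.
  by apply: (Pc i j _ _ i' j') => //; apply: gP.
have oL' i u : i < q -> u < t.+1 -> o i + u < L.
  by move=> /oL le ut; apply: leq_trans le; rewrite ltn_add2l.
pose B (i : 'I_q) := [set g i (o i + u) | u : 'I_t.+1].
have BP (i : 'I_q) x : x \in B i -> x \in P i.
  by case/imsetP => u _ ->; apply: gP => //; apply: oL'.
have cB i : #|B i| = t.+1.
  rewrite card_imset ?card_ord // => u v /gI[]; rewrite ?oL' // => _ /addnI.
  exact: val_inj.
have disj (i j : 'I_q) x : x \in B i -> x \in B j -> i = j.
  by move=> /BP xi /BP xj; apply: val_inj; apply: PD xi xj.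
have rainbow (i j : 'I_q) x y (i' j' : 'I_q) x' y' : i != j -> i' != j' ->
    x \in B i -> y \in B j -> x' \in B i' -> y' \in B j' ->
    c [set x; y] = c [set x'; y'] -> [set x; y] = [set x'; y'].
  by move=> ij ij' /BP xi /BP yj /BP xi' /BP yj'; apply: Pc xi yj xi' yj'.
have clean (i : 'I_q) x y (j l : 'I_q) z w : j != l -> x \in B i -> y \in B i -> x != y ->
    z \in B j -> w \in B l -> c [set x; y] != c [set z; w].
  move=> jl /imsetP[u _ ->] /imsetP[v _ ->] uv /imsetP[z' _ ->] /imsetP[w' _ ->].
  by apply: oP => //; apply: contraNneq uv => ->.
pose mono i a (M : {set 'I_n}) :=
  [&& M \subset B i, #|M| == k.+1 & [forall e in pairs M, c e == a]].
pose C i := colors_on c (pairs (B i)).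
pose few i := size (C i) <= q.
have /fin_all_exists[a0 a0P] i : exists a, few i -> [exists M, mono i a M].
  have [|rich|[a [M [MB Mk Ma]]]] := tP _ c (B i); first by rewrite cB.
    by exists 0; rewrite /few leqNgt rich.
  exists a => _; apply/existsP; exists M; rewrite /mono MB Mk eqxx /=.
  by apply/forall_inP => f /Ma ->.
case: (boolP [exists i, exists j, [&& i != j, few i, few j & a0 i == a0 j]]).
  case/existsP => i /existsP[j /and4P[ij fi fj /eqP aij]].
  have /existsP[M1 /and3P[M1B /eqP M1k /forall_inP M1a]] := a0P i fi.
  have /existsP[M2 /and3P[M2B /eqP M2k /forall_inP M2a]] := a0P j fj.
  (* a third part exists because q >= 3, that is, p >= 5 *)
  have [l] : exists l, l \in ~: [set i; j].
    apply/card_gt0P; have := cardsC [set i; j]; rewrite cards2 ij card_ord /q; lia.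
  rewrite !inE negb_or => /andP[li lj].
  have cz : #|take_set (~~ odd p) (B l)| = ~~ odd p.
    by rewrite card_take_set // cB; case: (odd p).
  have [|||||||||||X Xp XP] := @monochromatic_selection _ c q B rainbow clean disj i j l
    M1 (take_set k M2) (take_set (~~ odd p) (B l)) (a0 i) k => //.
  - by rewrite eq_sym.
  - by rewrite eq_sym.
  - exact: subset_trans (take_set_sub _ _) M2B.
  - exact: take_set_sub.
  - by rewrite card_take_set // M2k.
  - by rewrite cz; case: (odd p).
  - by move=> f /M1a /eqP.
  - by move=> f /(subsetP (pairsS (take_set_sub _ _))) /M2a /eqP; rewrite aij.
  by exists X => //; rewrite Xp cz -pk.
rewrite negb_exists => /forallP distinct.
have [|||a aI aC] := @distinct_representatives q C few a0.
- move=> i fi; have /existsP[M /and3P[MB /eqP Mk /forall_inP Ma]] := a0P i fi.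
  have /card_gt0P[f fM] : 0 < #|pairs M| by rewrite card_pairs Mk bin_gt0.
  rewrite mem_undup -(eqP (Ma f fM)); apply/mapP; exists f => //.
  by rewrite mem_enum (subsetP (pairsS MB)).
- move=> i j fi fj aij; apply/eqP; apply: contraT => ij.
  have := distinct i; rewrite negb_exists => /forallP/(_ j).
  by rewrite ij aij eqxx [few i]fi [few j]fj.
- by move=> i; rewrite -ltnNge => ->; rewrite undup_uniq.
have /fin_all_exists[f fP] i : exists f, f \in pairs (B i) /\ c f = a i.
  by have := aC i; rewrite mem_undup => /mapP[f]; rewrite mem_enum => fB ->; exists f.
apply: (@matching_selection _ c q B rainbow clean disj f).
- by rewrite /q; lia.
- by move=> i j /=; rewrite !(fP _).2 => /aI.
- by move=> i; case: (fP i).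
Qed.

(** * Asymptotics *)

Lemma forcing_number_gt n p : 4 < p ->
  turan_ex n (complete (uphalf p)) < forcing_number n (complete p) square_graphs.
Proof.
move=> p5; rewrite /forcing_number; case: ex_minnP => m /asboolP F _.
by rewrite ltnNge; apply/negP => /(not_forces_turan_ex p5); apply.
Qed.

Lemma turan_ex_unbounded p N : 4 < p ->
  exists n0, forall n, n0 <= n -> N <= turan_ex n (complete (uphalf p)).
Proof.
move=> p5; have [r r0 ->] : exists2 r, 0 < r & uphalf p = r.+2.
  by exists (uphalf p).-2; lia.
exists (2 + 2 * N * r.+1).+1 => n nn; have := turan_ex_balanced n r.
set x := turan_ex n _ => bal; rewrite leqNgt; apply/negP => xN.
have E1 : 2 * r.+1 * x <= 2 * N * r.+1 by rewrite mulnAC leq_mul2r leq_mul2l ltnW ?orbT.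
have E2 : r * n * (2 + 2 * N * r.+1).+1 <= r * n ^ 2 by rewrite -mulnn mulnA leq_mul2l nn orbT.
have E3 : n <= r * n by rewrite leq_pmull.
have E4 : 2 * N * r.+1 <= r * n * (2 * N * r.+1).
  by rewrite leq_pmull // muln_gt0 r0; lia.
by rewrite -addn1 2!mulnDr in E2; lia.
Qed.

Lemma turan_ex_gt0 n p : 4 < p -> p <= n -> 0 < turan_ex n (complete (uphalf p)).
Proof.
move=> p5 pn; have [r r0 ->] : exists2 r, 0 < r & uphalf p = r.+2.
  by exists (uphalf p).-2; lia.
have := turan_ex_balanced n r; case: turan_ex => // bal.
have E : r * n * 3 <= r * n ^ 2 by rewrite -mulnn mulnA leq_mul2l; apply/orP; right; lia.
have : n <= r * n by rewrite leq_pmull.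
by lia.
Qed.

(** The constant [2 D] leaves room for the rounding in
    [(D + 1) ex(n, K_q) / D]. *)
Lemma forcing_number_le p D : 4 < p -> 0 < D -> exists n0, forall n, n0 <= n ->
  D * forcing_number n (complete p) square_graphs <= D.+1 * turan_ex n (complete (uphalf p)).
Proof.
move=> p5 D0; have [|n1 n1P] := @forces_above_turan_ex p D.*2 p5; first by lia.
have [n2 n2P] := turan_ex_unbounded D.*2 p5.
exists (n1 + n2) => n nn; set x := turan_ex n _.
have xD : D.*2 <= x by apply: n2P; lia.
apply: (@leq_trans (D * (D.+1 * x %/ D))); last by rewrite mulnC leq_trunc_div.
rewrite leq_mul2l; apply/orP; right.
rewrite /forcing_number; case: ex_minnP => m _; apply; apply/asboolP.
apply: n1P; first by lia.
rewrite -/x; have := divn_eq (D.+1 * x) D; have := ltn_pmod (D.+1 * x) D0.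
by lia.
Qed.

From mathcomp Require Import all_boot all_order all_algebra.
From mathcomp Require Import all_classical all_reals all_analysis.
Import Order.TTheory GRing.Theory Num.Theory numFieldNormedType.Exports.
Local Open Scope classical_set_scope.
Local Open Scope ring_scope.

Theorem theorem7p1 (R : realType) (p : nat) (hp : (5 <= p)%N) :
  exists eps : nat -> R,
    (eps n @[n --> \oo] --> (0 : R)) /\
    (forall n : nat, (p <= n)%N ->
       (forcing_number n (complete p) square_graphs)%:R =
       (1 + eps n) * (turan_ex n (complete (uphalf p)))%:R :> R).
Proof.
pose f n := forcing_number n (complete p) square_graphs.
pose x n := turan_ex n (complete (uphalf p)).
exists (fun n => (f n)%:R / (x n)%:R - 1); split; last first.
  move=> n pn; rewrite subrKC divfK // pnatr_eq0 -lt0n.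
  exact: turan_ex_gt0.
apply/cvgr0Pnorm_le => e e0.
pose D := (Num.truncn e^-1).+1.
have De : D%:R^-1 <= e.
  by rewrite invf_ple ?posrE ?ltr0n // ltW // truncnS_gt.
have [n2 n2P] := @forcing_number_le p D hp isT.
exists (p + n2)%N => // n /= nn.
have x0 : 0 < (x n)%:R :> R by rewrite ltr0n turan_ex_gt0 // (leq_trans (leq_addr _ _) nn).
have gt := forcing_number_gt n hp.
have le := n2P n (leq_trans (leq_addl _ _) nn).
rewrite ger0_norm; last by rewrite subr_ge0 ler_pdivlMr // mul1r ler_nat ltnW.
apply: le_trans De; rewrite lerBlDr ler_pdivrMr //.
rewrite -(ler_pM2l (_ : 0 < D%:R)) ?ltr0n // mulrA mulrDr mulfV ?pnatr_eq0 // mulr1.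
by rewrite nat1r -!natrM ler_nat.
Qed.
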